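(* Let $n\ge1$, $s\in(0,1)$, let $a:\mathbb{R}^n\to\mathbb{R}$ be a nonnegative measurable function and let $u\in H^s(\mathbb{R}^n)$. If $$\int_{\mathbb{R}^n}\int_{\mathbb{R}^n}\frac{(u(x)-u(y))(v(x)-v(y))}{|x-y|^{n+2s}}dxdy+\int_{\mathbb{R}^n}a(x)u(x)v(x)\,dx\ge0$$ for all $v\in H^s(\mathbb{R}^n)$ with $v\ge0$ almost everywhere, then $u\ge0$ almost everywhere.
   Context: Functions are real-valued. $H^s(\mathbb{R}^n)$ is the space of $u\in L^2(\mathbb{R}^n)$ with $\int_{\mathbb{R}^n}\int_{\mathbb{R}^n}\frac{(u(x)-u(y))^2}{|x-y|^{n+2s}}dxdy<\infty$. The hypothesis is understood to include that, for each such $v$, the integral $\int_{\mathbb{R}^n}a u v\,dx$ is well defined (as an element of $[-\infty,+\infty]$). *)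

(* Defs.v *)
From HB Require Import structures.
From mathcomp Require Import all_boot all_order all_algebra.
From mathcomp Require Import all_classical all_reals all_analysis.

Set Implicit Arguments.
Unset Strict Implicit.
Unset Printing Implicit Defensive.

Import Order.TTheory GRing.Theory Num.Theory.
Import numFieldNormedType.Exports.

Local Open Scope classical_set_scope.
Local Open Scope ring_scope.
Local Open Scope ereal_scope.

Section borel_lebesgue.
Context {R : realType}.

Definition cons_pair n (p : measurableTypeR R * n.-tuple (measurableTypeR R)) :
  n.+1.-tuple (measurableTypeR R) := [tuple of p.1 :: p.2].

Lemma measurable_cons_pair n : measurable_fun setT (@cons_pair n).
Proof. exact: measurable_cons. Qed.

(* The restriction of Lebesgue measure on R^n to the Borel sets: the n-fold
   product of the one-dimensional measure, one coordinate at a time. *)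
Fixpoint borel_lebesgue n : set (n.-tuple (measurableTypeR R)) -> \bar R :=
  match n with
  | 0 => dirac [tuple]
  | n'.+1 => pushforward (@lebesgue_measure R \x @borel_lebesgue n')
                         (@cons_pair n')
  end.

Section borel_lebesgue_succ.
Variables (n : nat)
  (mu : {sigma_finite_measure set (n.-tuple (measurableTypeR R)) -> \bar R}).
Let nu := pushforward (@lebesgue_measure R \x mu) (@cons_pair n).

Let nu0 : nu set0 = 0.
Proof. by rewrite /nu /pushforward preimage_set0 measure0. Qed.

Let nu_ge0 A : 0 <= nu A.
Proof. by rewrite /nu /pushforward measure_ge0. Qed.

Let nu_sigma_additive : semi_sigma_additive nu.
Proof.
by apply: measure_semi_sigma_additive; exact: measurable_cons_pair.
Qed.

HB.instance Definition _ := isMeasure.Build _ _ _ nu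
  nu0 nu_ge0 nu_sigma_additive.

Let nu_sigma_finite : sigma_finite setT nu.
Proof.
have /sigma_finiteP[F [FT ndF Foo]] := sigma_finiteT (@lebesgue_measure R).
have /sigma_finiteP[G [GT ndG Goo]] := sigma_finiteT mu.
pose H k := [set t : n.+1.-tuple (measurableTypeR R) |
  F k (thead t) /\ G k [tuple of behead t]].
exists H.
  apply/esym; rewrite -subTset => t _.
  have [i _ Fi] : (\bigcup_k F k) (thead t) by rewrite -FT.
  have [j _ Gj] : (\bigcup_k G k) [tuple of behead t] by rewrite -GT.
  exists (maxn i j) => //; split.
    by move: Fi; apply/subsetPset/ndF/leq_maxl.
  by move: Gj; apply/subsetPset/ndG/leq_maxr.
move=> k; have [mF Fk] := Foo k; have [mG Gk] := Goo k; split.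
  apply: measurableI.
    by rewrite -[X in measurable X]setTI; exact: (measurable_tnth ord0).
  by rewrite -[X in measurable X]setTI; exact: measurable_behead.
rewrite /nu /pushforward (_ : _ @^-1` _ = F k `*` G k).
  by rewrite product_measure1E// lte_mul_pinfty// ge0_fin_numE.
have tlE x (t : n.-tuple (measurableTypeR R)) :
  [tuple of behead [tuple of x :: t]] = t by exact: val_inj.
by apply/seteqP; split => -[x t] [/= ? ?]; split => //=;
  rewrite ?tlE// -(tlE x t).
Qed.

HB.instance Definition _ := Measure_isSigmaFinite.Build _ _ _ nu
  nu_sigma_finite.

Definition borel_lebesgue_succ :
  {sigma_finite_measure set (n.+1.-tuple (measurableTypeR R)) -> \bar R} := nu.

End borel_lebesgue_succ.

Lemma borel_lebesgue_ex n :
  exists mu : {sigma_finite_measure set (n.-tuple (measurableTypeR R)) -> \bar R},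
    @borel_lebesgue n = mu.
Proof.
elim: n => [|n [mu muE]]; first by exists (dirac [tuple]).
by exists (borel_lebesgue_succ mu); rewrite /= muE.
Qed.

Section borel_lebesgue_measure.
Variable n : nat.
Local Notation mu := (@borel_lebesgue n).

Let mu0 : mu set0 = 0.
Proof. by have [m ->] := borel_lebesgue_ex n; exact: measure0. Qed.

Let mu_ge0 A : 0 <= mu A.
Proof. by have [m ->] := borel_lebesgue_ex n; exact: measure_ge0. Qed.

Let mu_sigma_additive : semi_sigma_additive mu.
Proof.
by have [m ->] := borel_lebesgue_ex n; exact: measure_semi_sigma_additive.
Qed.

HB.instance Definition _ := isMeasure.Build _ _ _ mu
  mu0 mu_ge0 mu_sigma_additive.

Let mu_sigma_finite : sigma_finite setT mu.
Proof. by have [m ->] := borel_lebesgue_ex n; exact: sigma_finiteT. Qed.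

HB.instance Definition _ := Measure_isSigmaFinite.Build _ _ _ mu
  mu_sigma_finite.

End borel_lebesgue_measure.

Lemma measurable_box n (A : 'I_n -> set (measurableTypeR R)) :
  (forall i, measurable (A i)) ->
  measurable [set x : n.-tuple (measurableTypeR R) | forall i, A i (tnth x i)].
Proof.
move=> mA; rewrite [X in measurable X](_ : _ =
  \bigcap_(i in [set: 'I_n]) ((@tnth _ _)^~ i @^-1` A i)); last first.
  by apply/seteqP; split=> x /= Ax i; [move=> _|]; exact: Ax.
apply: fin_bigcap_measurable => [|i _]; first exact: finite_finset.
by rewrite -[X in measurable X]setTI; exact: measurable_tnth.
Qed.

Lemma borel_lebesgue_box n (A : 'I_n -> set (measurableTypeR R)) :
  (forall i, measurable (A i)) ->
  borel_lebesgue [set x | forall i, A i (tnth x i)] =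
  \prod_(i < n) lebesgue_measure (A i).
Proof.
elim: n A => [|n IHn] A mA.
  by rewrite big_ord0 /= /dirac indicE mem_set//= => -[].
rewrite big_ord_recl -IHn//; rewrite /= /pushforward -product_measure1E//.
- congr (product_measure1 _ _ _); apply/seteqP; split => [[x t] /= At|[x t] [/= Ax At] i].
    split=> [|i /=]; first exact: (At ord0).
    by have := At (lift ord0 i); rewrite tnthS.
  by case: (unliftP ord0 i) => [j|] ->//; rewrite tnthS.
by apply: (@measurable_box n (fun i => A (lift ord0 i))) => i; exact: mA.
Qed.

End borel_lebesgue.

(* R^n with the sigma-algebra of Lebesgue-measurable sets, i.e. the Caratheodory
   measurable sets of the outer measure induced by [borel_lebesgue]. *)
Definition Rn (R : realType) (n : nat) :=
  caratheodory_type ((@borel_lebesgue R n)^*)%mu.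
HB.instance Definition _ (R : realType) (n : nat) := Measurable.on (Rn R n).

Section lebesgue_Rn.
Context {R : realType}.
Variable n : nat.

Definition leb : set (Rn R n) -> \bar R :=
  @completed_measure_extension _ _ _ (@borel_lebesgue R n).
HB.instance Definition _ := Measure.on leb.

Let leb_sigma_finite : sigma_finite setT leb.
Proof.
exact/completed_measure_extension_sigma_finite/(sigma_finiteT (@borel_lebesgue R n)).
Qed.

HB.instance Definition _ := Measure_isSigmaFinite.Build _ _ _ leb
  leb_sigma_finite.

Lemma leb_complete : measure_is_complete leb.
Proof. exact: measure_is_complete_caratheodory. Qed.

Lemma measurable_coord (i : 'I_n) :
  measurable_fun setT (fun x : Rn R n => tnth x i : R).
Proof.
move=> _ B mB; rewrite setTI; apply: caratheodory_measurable_mu_ext.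
by rewrite -[X in measurable X]setTI; exact: measurable_tnth.
Qed.

Lemma leb_box (A : 'I_n -> set (measurableTypeR R)) :
  (forall i, measurable (A i)) ->
  leb [set x : Rn R n | forall i, A i (tnth x i)] =
  \prod_(i < n) lebesgue_measure (A i).
Proof.
move=> mA; rewrite -borel_lebesgue_box//.
by apply: measurable_mu_extE; exact: measurable_box.
Qed.

End lebesgue_Rn.
Arguments leb {R} n.

Section fractional_sobolev.
Context {R : realType} {n : nat}.
Implicit Types (s : R) (u v : Rn R n -> R) (x y : Rn R n).

(* The norm of the library on row vectors is the sup norm, hence the explicit
   Euclidean distance. *)
Definition eucl_dist x y : R :=
  Num.sqrt (\sum_(i < n) ((tnth x i : R) - tnth y i) ^+ 2).

(* On the diagonal the quotient is 0 since [0^-1 = 0]; the diagonal is null. *)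
Definition gagliardo_form s u v : \bar R :=
  \int[leb n \x leb n]_z
    ((u z.1 - u z.2) * (v z.1 - v z.2)
     / eucl_dist z.1 z.2 `^ (n%:R + 2 * s))%:E.

Definition Hs s : set (Rn R n -> R) :=
  [set u | u \in Lfun (leb n) 2%:E /\
    \int[leb n \x leb n]_z
      ((u z.1 - u z.2) ^+ 2 / eucl_dist z.1 z.2 `^ (n%:R + 2 * s))%:E < +oo].

(* The integral of [f] makes sense in [-oo, +oo]: not of the form oo - oo, a
   case in which the integral of the library has a conventional value. *)
Definition integral_defined (f : Rn R n -> \bar R) : Prop :=
  \int[leb n]_x f^\+ x < +oo \/ \int[leb n]_x f^\- x < +oo.

End fractional_sobolev.

(* Main.v *)
Require Import Defs.
From HB Require Import structures.
From mathcomp Require Import all_boot all_order all_algebra.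
From mathcomp Require Import all_classical all_reals all_analysis.
From mathcomp Require Import measurable_realfun lra.

Set Implicit Arguments.
Unset Strict Implicit.
Unset Printing Implicit Defensive.

Import Order.TTheory GRing.Theory Num.Theory.
Import numFieldNormedType.Exports.

Local Open Scope classical_set_scope.
Local Open Scope ring_scope.
Local Open Scope ereal_scope.

(** The proof tests the inequality with [v = u^\-]. This is admissible, since
    truncation does not leave [Hs] ([Hs_funrneg]). The zeroth-order term
    [a u u^\- = - a (u^\-)^2] is nonpositive because [a] is nonnegative, so the
    Gagliardo form of [(u, u^\-)] must be nonnegative. But its integrand is at
    most [- (u^\- x - u^\- y)^2 / |x - y|^(n + 2s)] ([funrnegB_mul_le]), hence it
    vanishes almost everywhere and [u^\- x = u^\- y] for almost every pair
    ([ae_gagliardo_form_funrneg]).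

    Slicing the product measure at a well-chosen [x] ([ae_xsection],
    [ae_exists]) shows that [u^\-] is almost everywhere equal to a constant.
    As [u^\-] is square integrable and [R^n] has infinite measure ([lebT]), the
    constant is 0 ([Lfun_ae_cst_eq0]), which is the claim. *)

Section almost_everywhere_lemmas.
Context d1 d2 (T1 : measurableType d1) (T2 : measurableType d2) (R : realType).

Lemma ae_exists (mu : {measure set T1 -> \bar R}) (P : T1 -> Prop) :
  mu setT != 0 -> {ae mu, forall x, P x} -> exists x, P x.
Proof.
move=> mu0 aeP; apply: contrapT => /forallNP nP; move/eqP: mu0; apply.
apply/(negligibleP _ measurableT).
by apply: negligibleS aeP => x _ /=; exact: nP.
Qed.

(** The product measure of a set is the integral of the measures of its
    sections, so the sections of a null set are almost all null. *)
Lemma ae_xsection (m1 : {measure set T1 -> \bar R})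
    (m2 : {sigma_finite_measure set T2 -> \bar R}) (P : T1 * T2 -> Prop) :
  {ae m1 \x m2, forall z, P z} ->
  {ae m1, forall x, {ae m2, forall y, P (x, y)}}.
Proof.
move=> [N [mN N0 PN]].
have mNx := measurable_fun_xsection m2 mN.
have : \int[m1]_x `|(m2 \o xsection N) x| = 0.
  by rewrite -[RHS]N0; apply: eq_integral => x _; rewrite gee0_abs.
move=> /(ae_eq_integral_abs m1 measurableT mNx).
apply: filterS => x /(_ I) /= Nx0.
exists (xsection N x); split=> //; first exact: measurable_xsection.
by move=> y /= nP; rewrite /xsection /= inE; exact: PN.
Qed.

(** The integral is the difference of the integrals of the positive and negative
    parts, and here the positive part is identically 0. *)
Lemma integral_le0 (mu : {measure set T1 -> \bar R}) (f : T1 -> \bar R) :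
  (forall x, f x <= 0) -> \int[mu]_x f x <= 0.
Proof.
move=> f0; rewrite integralE [X in X - _]integral0_eq => [|x _].
  by rewrite sub0e oppe_le0 integral_ge0.
by rewrite funeposE; apply/max_idPr.
Qed.

Lemma Lfun_dominated (mu : {measure set T1 -> \bar R}) (r : R) (f g : T1 -> R) :
  (0 < r)%R -> measurable_fun setT f -> (forall x, `|f x| <= `|g x|)%R ->
  g \in Lfun mu r%:E -> f \in Lfun mu r%:E.
Proof.
move=> r0 mf fg Lg; have rn0 : r != 0%R by rewrite gt_eqF.
have [mg ng] : measurable_fun setT g /\ finite_norm mu r%:E g.
  by split; [have := sub_Lfun_mfun Lg|have := sub_Lfun_finLfun Lg]; rewrite inE.
have mpow (h : T1 -> R) : measurable_fun setT h -> measurable_fun setT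
    (fun x : T1 => `|(EFin \o h) x| `^ r).
  move=> mh; apply: (measurableT_comp (measurable_poweR r)) => /=.
  by apply/measurable_EFinP; exact: measurableT_comp.
apply/andP; rewrite !inE; split=> //=.
apply: (@lty_poweRy _ _ r) => //; rewrite poweR_Lnorm//.
apply: le_lt_trans (_ : \int[mu]_x (`|(EFin \o g) x| `^ r) < +oo).
  apply: ge0_le_integral => //; try exact: mpow.
    by move=> x _; exact: poweR_ge0.
  by move=> x _; rewrite lee_fin ge0_ler_powR ?nnegrE// ltW.
by rewrite -poweR_Lnorm// poweR_lty.
Qed.

(** Otherwise [`|f| `^ r] would integrate to [`|c| `^ r * +oo = +oo]. *)
Lemma Lfun_ae_cst_eq0 (mu : {measure set T1 -> \bar R}) (r c : R) (f : T1 -> R) :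
  (0 < r)%R -> mu setT = +oo -> f \in Lfun mu r%:E ->
  {ae mu, forall x, f x = c} -> c = 0%R.
Proof.
move=> r0 muoo Lf fc; have rn0 : r != 0%R by rewrite gt_eqF.
have [mf nf] : measurable_fun setT f /\ finite_norm mu r%:E f.
  by split; [have := sub_Lfun_mfun Lf|have := sub_Lfun_finLfun Lf]; rewrite inE.
apply: contrapT => /eqP c0.
have := poweR_lty r nf; rewrite poweR_Lnorm//.
rewrite (@ae_eq_integral _ _ _ mu _ (cst (`|c%:E| `^ r)))//; last 2 first.
- apply: (measurableT_comp (measurable_poweR r)) => /=.
  by apply/measurable_EFinP; exact: measurableT_comp.
- by apply: filterS fc => x /= -> _.
rewrite integral_cst// muoo gt0_muley ?ltxx// poweR_gt0//.
by rewrite abse_EFin lte_fin normr_gt0.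
Qed.

End almost_everywhere_lemmas.

Section negative_part.
Context {T : Type} {R : realFieldType}.
Implicit Types (f : T -> R) (x y : T).
Local Open Scope ring_scope.

Lemma normr_funrneg_le f x : `|f^\- x| <= `|f x|.
Proof.
rewrite ger0_norm ?funrneg_ge0// /funrneg ge_max normr_ge0 andbT.
by rewrite -normrN ler_norm.
Qed.

Lemma funrneg_mul_le0 f x : f x * f^\- x <= 0.
Proof. by rewrite /funrneg; case: (leP (- f x) 0) => ?; nra. Qed.

Lemma sqr_funrnegB_le f x y : (f^\- x - f^\- y) ^+ 2 <= (f x - f y) ^+ 2.
Proof.
(* If [f x] and [f y] are both nonnegative, this is what remains to be shown. *)
have := sqr_ge0 (f x - f y).
by rewrite /funrneg; case: (leP (- f x) 0) => ?; case: (leP (- f y) 0) => ?; nra.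
Qed.

(** The source of coercivity. With [f = f^\+ - f^\-], the product is
    [(f^\+ x - f^\+ y) * (f^\- x - f^\- y) - (f^\- x - f^\- y) ^+ 2], whose first
    term is nonpositive because [f^\+] and [f^\-] have disjoint supports. *)
Lemma funrnegB_mul_le f x y :
  (f x - f y) * (f^\- x - f^\- y) <= - (f^\- x - f^\- y) ^+ 2.
Proof.
by rewrite /funrneg; case: (leP (- f x) 0) => ?; case: (leP (- f y) 0) => ?; nra.
Qed.

End negative_part.

Section gagliardo.
Context {R : realType} {n : nat}.
Implicit Types (s p : R) (u v : Rn R n -> R) (x y : Rn R n).

Lemma lebT : (1 <= n)%N -> leb n [set: Rn R n] = +oo.
Proof.
case: n => // m _.
have -> : [set: Rn R m.+1] = [set x | forall i, setT (tnth x i)].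
  by apply/seteqP; split.
rewrite (@leb_box R m.+1 (fun=> setT))//.
have lT : @lebesgue_measure R setT = +oo.
  by rewrite -set_itvNyy lebesgue_measure_itv.
rewrite (eq_bigr (fun=> +oo)) => [|i _]; last exact: lT.
by elim: m => [|m IHm]; rewrite big_ord_recl ?big_ord0 ?mule1// IHm.
Qed.

Lemma eucl_dist_eq0 x y : eucl_dist x y = 0%R -> x = y.
Proof.
move=> /eqP; rewrite sqrtr_eq0 => sum_le0.
have /eqP : (\sum_(i < n) ((tnth x i : R) - tnth y i) ^+ 2 = 0)%R.
  by apply/le_anti; rewrite sum_le0 sumr_ge0// => i _; rewrite sqr_ge0.
rewrite psumr_eq0 => [/allP xy|i _]; last exact: sqr_ge0.
apply: eq_from_tnth => i; apply/eqP.
by have := xy i (mem_index_enum i); rewrite /= sqrf_eq0 subr_eq0.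
Qed.

(** The kernel is a Borel function of the coordinates, and these are measurable
    for the completed sigma-algebra of each factor. *)
Lemma measurable_gagliardo_integrand p u v :
  measurable_fun setT u -> measurable_fun setT v ->
  measurable_fun setT (fun z : Rn R n * Rn R n =>
    ((u z.1 - u z.2) * (v z.1 - v z.2) / eucl_dist z.1 z.2 `^ p)%:E).
Proof.
have mB (w : Rn R n -> R) : measurable_fun setT w ->
    measurable_fun setT (fun z : Rn R n * Rn R n => w z.1 - w z.2)%R.
  by move=> mw; apply: measurable_funB; exact: measurableT_comp.
move=> mu mv; apply/measurable_EFinP.
under eq_fun do rewrite -powRN.
apply: measurable_funM; first by apply: measurable_funM; exact: mB.
apply: (measurableT_comp (measurable_powR _)).
apply: (measurableT_comp (continuous_measurable_fun (@sqrt_continuous R))).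
apply: measurable_sum => i; apply: measurable_funX.
exact: (mB _ (measurable_coord i)).
Qed.

(** Truncation is 1-Lipschitz, hence increases neither the [L^2] norm nor any of
    the differences [`|u x - u y|] in the Gagliardo energy. *)
Lemma Hs_funrneg s u : Hs s u -> Hs s (u^\-)%R.
Proof.
move=> [u2 uoo]; have mu : measurable_fun setT u.
  by have := sub_Lfun_mfun u2; rewrite inE.
have mv := measurable_funrneg mu; split.
  by apply: (Lfun_dominated _ mv _ u2) => //; exact: normr_funrneg_le.
apply: le_lt_trans uoo; apply: ge0_le_integral => //.
- by move=> z _; rewrite lee_fin divr_ge0 ?sqr_ge0 ?powR_ge0.
- under eq_fun do rewrite expr2; exact: measurable_gagliardo_integrand.
- under eq_fun do rewrite expr2; exact: measurable_gagliardo_integrand.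
- move=> z _; rewrite lee_fin ler_wpM2r ?invr_ge0 ?powR_ge0//.
  exact: sqr_funrnegB_le.
Qed.

(** By [funrnegB_mul_le] the integrand is nonpositive, so a nonnegative integral
    forces it to vanish almost everywhere. Where it vanishes, either the same
    inequality kills [u^\- z.1 - u^\- z.2], or the distance is 0 and the two
    points coincide. *)
Lemma ae_gagliardo_form_funrneg s u : measurable_fun setT u ->
  0 <= gagliardo_form s u (u^\-)%R ->
  {ae leb n \x leb n, forall z, (u^\- z.1 = u^\- z.2)%R}.
Proof.
move=> mu gag_ge0; set p := (n%:R + 2 * s)%R.
pose F (z : Rn R n * Rn R n) :=
  ((u z.1 - u z.2) * (u^\- z.1 - u^\- z.2) / eucl_dist z.1 z.2 `^ p)%:E.
have F_le0 z : F z <= 0.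
  rewrite lee_fin mulr_le0_ge0 ?invr_ge0 ?powR_ge0//.
  by rewrite (le_trans (funrnegB_mul_le _ _ _))// oppr_le0 sqr_ge0.
have mF : measurable_fun setT F.
  by apply: measurable_gagliardo_integrand => //; exact: measurable_funrneg.
have : \int[leb n \x leb n]_z `|F z| = 0.
  apply/le_anti; rewrite [X in _ && X]integral_ge0 ?andbT//.
  under eq_integral do rewrite lee0_abs//.
  rewrite -oppe_ge0 -integral_ge0N => [|z _]; last by rewrite oppe_ge0.
  by under eq_integral do rewrite oppeK.
move=> /(ae_eq_integral_abs _ measurableT mF); apply: filterS => -[x y] /(_ I).
move=> [/eqP]; rewrite mulf_eq0 => /orP[/eqP uv0|]; last first.
  rewrite invr_eq0 => /eqP/powR_eq0_eq0/eucl_dist_eq0/= -> //.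
have := funrnegB_mul_le u x y; rewrite uv0 oppr_ge0 => vv_le0.
by apply/eqP; rewrite -subr_eq0 -sqrf_eq0 eq_le vv_le0 sqr_ge0.
Qed.

End gagliardo.

Theorem lemma4p1 (R : realType) (n : nat) (s : R) (a u : Rn R n -> R)
    (n_ge1 : (1 <= n)%N) (s_gt0 : (0 < s)%R) (s_lt1 : (s < 1)%R)
    (a_ge0 : forall x, (0 <= a x)%R) (a_meas : measurable_fun [set: Rn R n] a)
    (u_Hs : Hs s u)
    (uE : forall v : Rn R n -> R, Hs s v ->
      {ae leb n, forall x, (0 <= v x)%R} ->
      integral_defined (fun x => (a x * u x * v x)%:E) /\
      0 <= gagliardo_form s u v + \int[leb n]_x (a x * u x * v x)%:E) :
  {ae leb n, forall x, (0 <= u x)%R}.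
Proof.
have vHs := Hs_funrneg u_Hs.
have mu : measurable_fun setT u.
  by have := sub_Lfun_mfun u_Hs.1; rewrite inE.
have [|_ form_ge0] := uE (u^\-)%R vHs.
  by apply: aeW => x; exact: funrneg_ge0.
have auv_le0 : \int[leb n]_x (a x * u x * u^\- x)%:E <= 0.
  apply: integral_le0 => x; rewrite lee_fin -mulrA mulr_ge0_le0//.
  exact: funrneg_mul_le0.
have gag_ge0 : 0 <= gagliardo_form s u (u^\-)%R.
  exact: le_trans form_ge0 (geeDl _ auv_le0).
have leb_oo := @lebT R _ n_ge1.
have [x vx] : exists x, {ae leb n, forall y, (u^\- x = u^\- y)%R}.
  have leb_neq0 : leb n [set: Rn R n] != 0 by rewrite leb_oo.
  apply: (ae_exists leb_neq0).
  exact: ae_xsection (ae_gagliardo_form_funrneg mu gag_ge0).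
have vx0 : (u^\- x = 0)%R.
  by apply: (Lfun_ae_cst_eq0 _ leb_oo vHs.1) => //; apply: filterS vx.
apply: filterS vx => y; rewrite vx0 => /esym vy0.
by rewrite -oppr_le0 -vy0 /funrneg le_max lexx.
Qed.
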